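(* Consider the continuous-time Markov chain on $\mathcal{K}_h$ with the transition rates $c(i,\pm_j)$ given in the context and transition function $(p_t)_{t\ge0}$. Suppose that $\kappa_+(i,j)>0$ for all $j\in\{1,\dots,d\}$ and all $i\in\mathcal{K}_h$ with $i+he_j\in\mathcal{K}_h$, and $\kappa_-(i,j)>0$ for all $j\in\{1,\dots,d\}$ and all $i\in\mathcal{K}_h$ with $i-he_j\in\mathcal{K}_h$, where $$\kappa_\pm(i,j)=c(i,\pm_j)-c(i\pm he_j,\pm_j)-\sum_{\gamma\in G\setminus\{+_j,-_j\}}\max\{c(i\pm he_j,\gamma)-c(i,\gamma),0\}.$$ Then for all probability measures $\nu,\eta$ on $\mathcal{K}_h$, $$\mathcal{W}_1(\nu p_t,\eta p_t)\le\sqrt{d}\,e^{-\kappa_1t}\,\mathcal{W}_1(\nu,\eta)\quad\text{for all }t\ge0,$$ where $$\kappa_1=\min\big\{\kappa_+(i,j)+\kappa_-(i+he_j,j):\ j=1,\dots,d,\ i,\,i+he_j\in\mathcal{K}_h\big\}.$$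
   Context: Setting. Let $d\ge1$, $K>0$, $D=[-K,K]^d$, $h>0$ with $2K/h\in\mathbb{N}$, $\sigma>0$, $V\in C^2(\mathbb{R}^d)$, and let $e_1,\dots,e_d$ be the standard basis of $\mathbb{R}^d$. The grid is $\mathcal{K}_h=\{i=(i_1,\dots,i_d): i_j=-K+hn_j-h/2,\ n_j\in\{1,\dots,2K/h\}\}$. Put $V^h(i)=h^{-d}\int_{[-h/2,h/2]^d}V(i+s)\,ds$. Let $G=\{+_1,-_1,\dots,+_d,-_d\}$ be the set of moves, where $\pm_j$ acts by $i\mapsto i\pm he_j$; write $\gamma i$ for the image of $i$ under $\gamma$. The transition rates are $c(i,\pm_j)=\frac{\sigma^2}{h^2}e^{-(V^h(i\pm he_j)-V^h(i))/(2\sigma^2)}$ if $i\pm he_j\in\mathcal{K}_h$ and $c(i,\pm_j)=0$ otherwise. The generator is $\mathcal{L}_hf(i)=\sum_{\gamma\in G}c(i,\gamma)(f(\gamma i)-f(i))$, and $p_t=e^{t\mathcal{L}_h}$ is the transition function; $\nu p_t$ is the law at time $t$ of the chain started from $\nu$. $\mathcal{W}_1(\nu,\eta)=\inf_{\gamma\in\Gamma(\nu,\eta)}\int_{\mathcal{K}_h\times\mathcal{K}_h}|x-y|\,\gamma(dx\,dy)$, where $|\cdot|$ is the Euclidean norm and $\Gamma(\nu,\eta)$ is the set of probability measures on $\mathcal{K}_h\times\mathcal{K}_h$ with marginals $\nu$ and $\eta$. *)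

(* Defs.v *)
From HB Require Import structures.
From mathcomp Require Import all_boot all_order all_algebra finmap.
From mathcomp Require Import all_classical all_reals all_analysis.

Set Implicit Arguments.
Unset Strict Implicit.
Unset Printing Implicit Defensive.

Import Order.TTheory GRing.Theory Num.Theory.
Import numFieldNormedType.Exports.

Local Open Scope classical_set_scope.
Local Open Scope ring_scope.

Section TupleProductMeasure.
Context d (T : measurableType d) (R : realType) (n : nat).
Variable m1 : {sigma_finite_measure set T -> \bar R}.
Variable m2 : {sigma_finite_measure set (n.-tuple T) -> \bar R}.

Definition tcons (p : T * n.-tuple T) : n.+1.-tuple T :=
  [the n.+1.-tuple T of p.1 :: p.2].

Lemma measurable_tcons : measurable_fun setT tcons.
Proof. by apply: measurable_cons. Qed.

Definition tcons_product : set (n.+1.-tuple T) -> \bar R :=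
  pushforward (m1 \x m2)%E tcons.

Let m := [the {measure set (T * n.-tuple T) -> \bar R} of (m1 \x m2)%E].

Let tcons_product0 : tcons_product set0 = 0%E.
Proof. by rewrite /tcons_product /pushforward preimage_set0 measure0. Qed.

Let tcons_product_ge0 A : (0 <= tcons_product A)%E.
Proof. exact: (measure_ge0 m). Qed.

Let tcons_product_sigma_additive : semi_sigma_additive tcons_product.
Proof.
move=> F mF tF mUF; rewrite /tcons_product /pushforward preimage_bigcup.
apply: (@measure_semi_sigma_additive _ _ _ m).
- move=> k; rewrite -[X in measurable X]setTI; exact: measurable_tcons.
- apply/trivIsetP => /= i j _ _ ij; rewrite -preimage_setI.
  by move/trivIsetP : tF => /(_ i j) -> //; rewrite preimage_set0.
- rewrite -preimage_bigcup -[X in measurable X]setTI.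
  exact: measurable_tcons.
Qed.

HB.instance Definition _ := isMeasure.Build _ _ _
  tcons_product tcons_product0 tcons_product_ge0 tcons_product_sigma_additive.

Let tcons_product_sigma_finite : sigma_finite setT tcons_product.
Proof.
have /sigma_finiteP[F [TF ndF Foo]] := sigma_finiteT m1.
have /sigma_finiteP[G [TG ndG Goo]] := sigma_finiteT m2.
pose u (s : n.+1.-tuple T) : T * n.-tuple T := (thead s, [tuple of behead s]).
have tconsK : cancel tcons u.
  move=> [a s]; rewrite /u /tcons /=; congr pair.
  by apply: val_inj.
have mu_ : measurable_fun setT u.
  apply/measurable_fun_pairP; split => /=.
    exact: measurable_tnth.
  exact: measurable_behead.
exists (fun i => u @^-1` (F i `*` G i)).
  rewrite -preimage_bigcup (_ : \bigcup_i _ = setT) ?preimage_setT//.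
  rewrite -subTset -setXTT TF TG => -[x y] [/= [i _ Fix] [k _ Gky]].
  exists (maxn i k) => //; split.
  - by move: x Fix; exact/subsetPset/ndF/leq_maxl.
  - by move: y Gky; exact/subsetPset/ndG/leq_maxr.
move=> i; have [mF ?] := Foo i; have [mG ?] := Goo i; split.
  by rewrite -[X in measurable X]setTI; apply: mu_ => //; exact: measurableX.
rewrite /tcons_product /pushforward -comp_preimage.
rewrite (_ : u \o tcons = id); last by apply/funext => p /=; rewrite tconsK.
by rewrite preimage_id product_measure1E// lte_mul_pinfty// ge0_fin_numE.
Qed.

HB.instance Definition _ := Measure_isSigmaFinite.Build _ _ _
  tcons_product tcons_product_sigma_finite.

End TupleProductMeasure.

Section TupleLebesgue.
Context (R : realType).
Local Notation T := (measurableTypeR R).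

(* Lebesgue measure on R^d, on the product sigma-algebra of d-tuples: the
   iterated product of the one-dimensional Lebesgue measure. *)
Fixpoint tuple_lebesgue d : {sigma_finite_measure set (d.-tuple T) -> \bar R} :=
  match d with
  | 0 => \d_ ([tuple] : 0.-tuple T)
  | n.+1 => tcons_product lebesgue_measure (tuple_lebesgue n)
  end.

Lemma tuple_lebesgue_box d (a b : 'I_d -> R) : (forall j, a j <= b j) ->
  tuple_lebesgue d [set s | forall j, tnth s j \in `[a j, b j]] =
  (\prod_(j < d) (b j - a j))%:E.
Proof.
elim: d a b => [|n IH] a b ab /=.
  rewrite big_ord0 diracE mem_set //. by case.
rewrite big_ord_recl EFinM -IH //.
rewrite /tcons_product /pushforward.
rewrite (_ : _ @^-1` _ = `[a ord0, b ord0] `*`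
  [set s | forall j, tnth s j \in `[a (lift ord0 j), b (lift ord0 j)]]); last first.
  apply/seteqP; split => -[x s] /=.
    move=> H; split; first by have := H ord0.
    by move=> j; have := H (lift ord0 j); rewrite tnthS.
  move=> [Hx Hs] j; case: (unliftP ord0 j) => [k ->|->]; last by [].
  by rewrite tnthS; apply: Hs.
rewrite product_measure1E.
- congr (_ * _)%E; rewrite [LHS](lebesgue_measure_itv `[a ord0, b ord0]) /=.
  by rewrite lte_fin; case: ltgtP (ab ord0) => // ->; rewrite subrr.
- exact: measurable_itv.
- rewrite (_ : [set s | _] = \bigcap_(j in setT) ((fun s : n.-tuple T => tnth s j) @^-1` `[a (lift ord0 j), b (lift ord0 j)])).
  apply: fin_bigcap_measurable => // j _.
  rewrite -[X in measurable X]setTI; apply: measurable_tnth => //.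
  apply/seteqP; split => s /= H; first by move=> j _; exact: H.
  by move=> j; exact: H.
Qed.
End TupleLebesgue.

Section Smoothness.
Context (R : realType) (d : nat).

Fixpoint Ck (k : nat) (f : 'rV[R]_d -> R) : Prop :=
  match k with
  | 0 => continuous f
  | k'.+1 => continuous f /\
      forall j : 'I_d, (forall x, derivable f x (delta_mx 0 j)) /\
                       Ck k' (fun x => 'D_(delta_mx 0 j) f x)
  end.

End Smoothness.

Section Wasserstein.
Context (R : realType) (d : nat).

(* The library norm on 'rV[R]_d is the sup norm. *)
Definition eucl_norm (x : 'rV[R]_d) : R := Num.sqrt (\sum_j x 0 j ^+ 2).

Definition is_pmf (T : finType) (p : T -> R) : Prop :=
  (forall x, 0 <= p x) /\ \sum_x p x = 1.

Definition is_coupling (T : finType) (nu eta : T -> R) (g : T * T -> R) : Prop :=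
  [/\ is_pmf g, forall x, \sum_y g (x, y) = nu x
              & forall y, \sum_x g (x, y) = eta y].

Definition W1 (S : {fset 'rV[R]_d}) (nu eta : S -> R) : R :=
  inf [set w | exists2 g : S * S -> R, is_coupling nu eta g &
         w = \sum_(xy : S * S) eucl_norm (val xy.1 - val xy.2) * g xy].

End Wasserstein.

Section Chain.
Context (R : realType) (d : nat).
Variables (K h sigma : R) (N : nat) (V : 'rV[R]_d -> R).

(* The points with coordinates -K + h n_j - h/2, 1 <= n_j <= N, where
   N = 2K/h; the value of [n j] is n_j - 1. *)
Definition grid : {fset 'rV[R]_d} :=
  [fset (\row_j (- K + h * (n j).+1%:R - h / 2) : 'rV[R]_d)
     | n : {ffun 'I_d -> 'I_N} in predT]%fset.

Definition Vh (x : 'rV[R]_d) : R :=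
  h ^- d * \int[tuple_lebesgue R d]_(s in
             [set s : d.-tuple (measurableTypeR R) |
               forall j, tnth s j \in `[- (h / 2), h / 2]])
             V (x + \row_j tnth s j).

(* (j, true) stands for +_j and (j, false) for -_j. *)
Local Notation move := ('I_d * bool)%type.

Definition step (g : move) (x : 'rV[R]_d) : 'rV[R]_d :=
  if g.2 then x + h *: delta_mx 0 g.1 else x - h *: delta_mx 0 g.1.

Definition rate (x : 'rV[R]_d) (g : move) : R :=
  if step g x \in grid
  then sigma ^+ 2 / h ^+ 2 *
       expR (- ((Vh (step g x) - Vh x) / (2 * sigma ^+ 2)))
  else 0.

(* [insubd x] only redirects the moves that leave the grid, whose rate is 0. *)
Definition generator (f : grid -> R) (x : grid) : R :=
  \sum_(g : move) rate (val x) g * (f (insubd x (step g (val x))) - f x).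

(* e^{tL} f, as the pointwise limit of its power series. *)
Definition semigroup (t : R) (f : grid -> R) (x : grid) : R :=
  limn (series (fun k => t ^+ k / k`!%:R * iter k generator f x)).

Definition transition (t : R) (x y : grid) : R :=
  semigroup t (fun z => (z == y)%:R) x.

Definition evolve (nu : grid -> R) (t : R) (y : grid) : R :=
  \sum_x nu x * transition t x y.

(* kappa (j, true) x is kappa_+(x, j) and kappa (j, false) x is kappa_-(x, j). *)
Definition kappa (g : move) (x : 'rV[R]_d) : R :=
  rate x g - rate (step g x) g -
  \sum_(g' : move | g'.1 != g.1)
     Num.max (rate (step g x) g' - rate x g') 0.

(* The minimum over a finite set; for d > 0 and N > 0 the set is empty only
   when the grid is a single point (N = 1), and then the value is 0. *)
Definition kappa1 : R :=
  inf [set k | exists j : 'I_d, exists x : 'rV[R]_d,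
         [/\ x \in grid, step (j, true) x \in grid &
             k = kappa (j, true) x + kappa (j, false) (step (j, true) x)]].

End Chain.

(* Main.v *)
Require Import Defs.
From HB Require Import structures.
From mathcomp Require Import all_boot all_order all_algebra finmap.
From mathcomp Require Import all_classical all_reals all_analysis.
From mathcomp Require Import ring lra.

Import Order.TTheory GRing.Theory Num.Theory.
Import numFieldNormedType.Exports.

Local Open Scope classical_set_scope.
Local Open Scope ring_scope.

(* For two adjacent grid points x and y = g x, run the two chains so that common
   moves are made together, and every excess move of one point along another
   axis is made while the other point steps onto its former position. The pair
   then stays adjacent until it meets, which happens at rate
   kappa_g(x) + kappa_(-g)(y) >= kappa_1, so the expected l^1 distance decays
   like exp(- kappa_1 t). Gluing these couplings along an l^1-geodesic of the
   grid, and then mixing them over a coupling of the initial laws, gives the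
   contraction for l^1, and |.| <= l^1 <= sqrt d |.| costs the factor sqrt d.
   Positivity and the decay estimate for e^{tL} are obtained from
   e^{ct} e^{tL} = e^{t(L + c)}, where L + c has nonnegative entries. *)

(** * Cauchy product with an exponential series *)

Section CauchyProduct.
Context {R : realType}.
Implicit Types u v : nat -> R.

(** With [j] the index of [v], the convolution collects the index pairs of the square with
    [i + j < n]; the pairs on or above that antidiagonal remain. *)
Lemma cauchy_product_error u v n :
  (\sum_(i < n) u i) * (\sum_(j < n) v j) -
    \sum_(k < n) \sum_(i < k.+1) u (k - i)%N * v i =
  \sum_(i < n) \sum_(j < n | (n <= i + j)%N) u i * v j.
Proof.
suff -> : \sum_(k < n) \sum_(i < k.+1) u (k - i)%N * v i =
    \sum_(i < n) \sum_(j < n | ~~ (n <= i + j)%N) u i * v j.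
  rewrite mulr_suml -sumrB; apply: eq_bigr => i _.
  rewrite mulr_sumr (bigID (fun j : 'I_n => (n <= i + j)%N)) /=.
  by rewrite addrK.
transitivity (\sum_(k < n) \sum_(i < n | (i <= k)%N) u (k - i)%N * v i).
  apply: eq_bigr => k _.
  by rewrite (big_ord_widen n (fun i => u (k - i)%N * v i)).
rewrite (exchange_big_dep predT) //= [RHS](exchange_big_dep predT) //=.
apply: eq_bigr => j _.
under [RHS]eq_bigl do rewrite -ltnNge.
rewrite -(big_mkord (fun k => (j <= k)%N) (fun k => u (k - j)%N * v j)).
rewrite -(big_mkord (fun i => (i + j < n)%N) (fun i => u i * v j)).
rewrite (big_cat_nat (n := j)) //=; last exact: ltnW.
rewrite big_nat_cond big_pred0 ?add0r; last first.
  by move=> k; case: leqP => //=; case: leqP => //; rewrite ?andbF.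
rewrite -{1}[j : nat]add0n big_addn.
rewrite (big_nat_widen 0 (n - j) n) ?leq_subr//.
by apply: eq_big => [i|i _]; rewrite ?addnK// leq_addl /= ltn_subRL addnC.
Qed.

Lemma exp_coeff_binomial (x y : R) k :
  exp_coeff (x + y) k = \sum_(i < k.+1) exp_coeff x (k - i)%N * exp_coeff y i.
Proof.
rewrite /exp_coeff /= exprDn mulr_suml; apply: eq_bigr => i _.
have ik : (i <= k)%N by rewrite -ltnS.
have fn0 m : m`!%:R != 0 :> R by rewrite pnatr_eq0 -lt0n fact_gt0.
rewrite -(bin_fact ik) !natrM -[X in X / _ = _]mulr_natr.
have b0 : ('C(k, i))%:R != 0 :> R by rewrite pnatr_eq0 -lt0n bin_gt0.
by field; rewrite !fn0 b0.
Qed.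

Lemma cvg_exp_coeff_sum (x : R) :
  (fun n => \sum_(i < n) exp_coeff x i) @ \oo --> expR x.
Proof.
have := @is_cvg_series_exp_coeff R x.
by rewrite /expR seriesEord; move=> xcvg; exact: xcvg.
Qed.

(* The error of the truncated Cauchy product is dominated termwise by the error
   for the product of two exponentials, which vanishes by the functional
   equation of [expR]. *)
Lemma cvg_cauchy_product_exp (c m C : R) v (l : R) : 0 <= c -> 0 <= m ->
  (forall k, `|v k| <= C * exp_coeff m k) ->
  (fun n => \sum_(k < n) v k) @ \oo --> l ->
  (fun n => \sum_(k < n) \sum_(i < k.+1) exp_coeff c (k - i)%N * v i) @ \oo
     --> expR c * l.
Proof.
move=> c0 m0 vC vl.
have Ec := cvg_exp_coeff_sum c; have Em := cvg_exp_coeff_sum m.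
have Ecm := cvg_exp_coeff_sum (c + m).
have main : (fun n => (\sum_(i < n) exp_coeff c i) * (\sum_(j < n) v j))
    @ \oo --> expR c * l by exact: cvgM.
have errC : (fun n => C * ((\sum_(i < n) exp_coeff c i) *
    (\sum_(j < n) exp_coeff m j) - \sum_(k < n) exp_coeff (c + m) k))
    @ \oo --> (0 : R).
  have e0 : C * (expR c * expR m - expR (c + m)) = 0.
    by rewrite expRD subrr mulr0.
  rewrite -[X in _ --> X]e0; apply: cvgM; first exact: cvg_cst.
  by apply: cvgB => //; exact: cvgM.
have errN : (fun n => - (C * ((\sum_(i < n) exp_coeff c i) *
    (\sum_(j < n) exp_coeff m j) - \sum_(k < n) exp_coeff (c + m) k)))
    @ \oo --> (0 : R).
  by rewrite -[X in _ --> X]oppr0; apply: cvgN.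
have bound n : `|(\sum_(i < n) exp_coeff c i) * (\sum_(j < n) v j) -
    \sum_(k < n) \sum_(i < k.+1) exp_coeff c (k - i)%N * v i| <=
    C * ((\sum_(i < n) exp_coeff c i) *
    (\sum_(j < n) exp_coeff m j) - \sum_(k < n) exp_coeff (c + m) k).
  under [X in C * (_ - X)]eq_bigr do rewrite exp_coeff_binomial.
  rewrite !cauchy_product_error mulr_sumr.
  apply: le_trans (ler_norm_sum _ _ _) _; apply: ler_sum => i _.
  rewrite mulr_sumr.
  apply: le_trans (ler_norm_sum _ _ _) _; apply: ler_sum => j _.
  have e0 : 0 <= exp_coeff c i by exact: exp_coeff_ge0.
  by rewrite normrM (ger0_norm e0) mulrCA ler_wpM2l.
have err : (fun n => (\sum_(i < n) exp_coeff c i) * (\sum_(j < n) v j) -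
    \sum_(k < n) \sum_(i < k.+1) exp_coeff c (k - i)%N * v i) @ \oo --> (0 : R).
  apply: squeeze_cvgr errN errC.
  by apply: nearW => n; rewrite -ler_norml bound.
rewrite -[expR c * l]subr0.
rewrite [X in X @ _ --> _](_ : _ = (fun n => (\sum_(i < n) exp_coeff c i) *
    (\sum_(j < n) v j)) - (fun n => (\sum_(i < n) exp_coeff c i) *
    (\sum_(j < n) v j) -
    \sum_(k < n) \sum_(i < k.+1) exp_coeff c (k - i)%N * v i)).
  exact: cvgB main err.
by apply/funext => n; rewrite !fctE opprB addrC subrK.
Qed.

End CauchyProduct.

(** * Semigroups of jump generators on a finite set *)

(** Jumps are indexed by moves instead of matrix entries, so that a coupling can prescribe what each
    single event does to both points. *)
Definition jump_gen {R : realType} {T I : finType} (r : T -> I -> R)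
    (s : T -> I -> T) (f : T -> R) (x : T) : R :=
  \sum_i r x i * (f (s x i) - f x).

(** The same power series as in [semigroup], for an arbitrary jump generator; it also serves for the
    chain on pairs. *)
Definition exp_gen {R : realType} {T I : finType} (r : T -> I -> R)
    (s : T -> I -> T) (t : R) (f : T -> R) (x : T) : R :=
  limn (series (fun k => t ^+ k / k`!%:R * iter k (jump_gen r s) f x)).

Section JumpGenerator.
Context {R : realType} {T I : finType} (r : T -> I -> R) (s : T -> I -> T).
Local Notation A := (jump_gen r s).

Lemma jump_gen_sum (J : finType) (a : J -> R) (F : J -> T -> R) x :
  A (fun y => \sum_j a j * F j y) x = \sum_j a j * A (F j) x.
Proof.
rewrite /jump_gen; under eq_bigr do rewrite -sumrB mulr_sumr.
rewrite exchange_big; apply: eq_bigr => j _; rewrite mulr_sumr.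
by apply: eq_bigr => i _; ring.
Qed.

Lemma iter_jump_gen_sum (J : finType) (a : J -> R) (F : J -> T -> R) k x :
  iter k A (fun y => \sum_j a j * F j y) x = \sum_j a j * iter k A (F j) x.
Proof.
elim: k x => [//|k IH] x /=.
by rewrite -jump_gen_sum; congr (A _ x); apply/funext.
Qed.

Lemma iter_jump_genD f g a k x :
  iter k A (fun y => f y + a * g y) x = iter k A f x + a * iter k A g x.
Proof.
have := @iter_jump_gen_sum bool (fun b => if b then 1 else a)
  (fun b => if b then f else g) k x.
rewrite big_bool /= mul1r => <-; congr (iter k A _ x).
by apply/funext => y; rewrite big_bool /= mul1r.
Qed.

Lemma iter_jump_genN f k x : iter k A (fun y => - f y) x = - iter k A f x.
Proof.
have := @iter_jump_gen_sum unit (fun=> -1) (fun=> f) k x.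
rewrite big_const card_unit /= addr0 mulN1r => <-; congr (iter k A _ x).
by apply/funext => y; rewrite big_const card_unit /= addr0 mulN1r.
Qed.

(** A crude bound on the operator norm of [A] for the sup norm: each difference [f (s x i) - f x]
    costs a factor 2, and the sum over [x] dominates every row. *)
Let M := \sum_x \sum_i 2 * `|r x i|.

Let M_ge0 : 0 <= M.
Proof. by apply: sumr_ge0 => x _; apply: sumr_ge0 => i _; rewrite mulr_ge0. Qed.

Lemma norm_iter_jump_gen f k x :
  `|iter k A f x| <= (\sum_y `|f y|) * M ^+ k.
Proof.
elim: k x => [|k IH] x.
  by rewrite expr0 mulr1 (bigD1 x) //= lerDl sumr_ge0.
rewrite exprSr mulrA iterS /jump_gen.
set u := iter k A f; set C := _ * _ ^+ _.
apply: le_trans (ler_norm_sum _ _ _) _.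
apply: (@le_trans _ _ (C * \sum_i 2 * `|r x i|)).
  rewrite mulr_sumr; apply: ler_sum => i _; rewrite normrM.
  have := ler_normB (u (s x i)) (u x); have := IH (s x i); have := IH x.
  rewrite -/u -/C; have := normr_ge0 (r x i); nra.
rewrite ler_wpM2l//.
  by apply: mulr_ge0; [exact: sumr_ge0 | exact: exprn_ge0].
rewrite /M (bigD1 x) //= lerDl sumr_ge0 // => y _.
by apply: sumr_ge0 => i _; rewrite mulr_ge0.
Qed.

Let term t f x k := t ^+ k / k`!%:R * iter k A f x.

Lemma norm_exp_gen_term t f x k : 0 <= t ->
  `|term t f x k| <= (\sum_y `|f y|) * exp_coeff (t * M) k.
Proof.
move=> t0; rewrite /term /exp_coeff /= normrM ger0_norm; last first.
  by rewrite divr_ge0 ?exprn_ge0.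
rewrite exprMn mulrC (_ : _ * (_ * _ / _) =
  (\sum_y `|f y|) * M ^+ k * (t ^+ k / k`!%:R)); last by ring.
by rewrite ler_wpM2r ?norm_iter_jump_gen// divr_ge0 ?exprn_ge0.
Qed.

(** The series is dominated by a multiple of the exponential series of [t * M], so the [limn] in
    [exp_gen] is a genuine limit. *)
Lemma cvg_exp_gen t f x : 0 <= t ->
  (fun n => \sum_(k < n) t ^+ k / k`!%:R * iter k A f x) @ \oo -->
  exp_gen r s t f x.
Proof.
move=> t0; have : cvgn (series (term t f x)).
  apply: normed_cvg.
  apply: (@series_le_cvg _ _
    (fun k => (\sum_y `|f y|) * exp_coeff (t * M) k)).
  - by move=> k /=.
  - by move=> k; rewrite mulr_ge0 ?sumr_ge0// exp_coeff_ge0 // mulr_ge0.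
  - by move=> k; exact: norm_exp_gen_term.
  - rewrite seriesEord /=; under eq_fun do rewrite -mulr_sumr.
    by apply: is_cvgM; [exact: is_cvg_cst | exact: cvgP (cvg_exp_coeff_sum _)].
rewrite /exp_gen !seriesEord; move=> c; exact: c.
Qed.

Lemma exp_genE t f x l :
  (fun n => \sum_(k < n) t ^+ k / k`!%:R * iter k A f x) @ \oo --> l ->
  exp_gen r s t f x = l.
Proof. by move=> H; rewrite /exp_gen seriesEord; exact: cvg_lim. Qed.

Lemma exp_gen_sum (J : finType) (a : J -> R) (F : J -> T -> R) t x : 0 <= t ->
  exp_gen r s t (fun y => \sum_j a j * F j y) x =
  \sum_j a j * exp_gen r s t (F j) x.
Proof.
move=> t0; apply: exp_genE.
rewrite [X in X @ _ --> _](_ : _ = (fun n => \sum_j a j *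
    \sum_(k < n) t ^+ k / k`!%:R * iter k A (F j) x)).
  apply: cvg_big => [|j _]; first exact: add_continuous.
  by apply: cvgM; [exact: cvg_cst | exact: cvg_exp_gen].
apply/funext => n; under [RHS]eq_bigr do rewrite mulr_sumr.
rewrite exchange_big; apply: eq_bigr => k _.
by rewrite iter_jump_gen_sum mulr_sumr; apply: eq_bigr => j _; rewrite mulrCA.
Qed.

Lemma exp_genN t f x : 0 <= t ->
  exp_gen r s t (fun y => - f y) x = - exp_gen r s t f x.
Proof.
move=> t0; apply: exp_genE.
rewrite [X in X @ _ --> _](_ : _ =
    - (fun n => \sum_(k < n) t ^+ k / k`!%:R * iter k A f x)).
  by apply: cvgN; exact: cvg_exp_gen.
apply/funext => n; rewrite fctE -sumrN; apply: eq_bigr => k _.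
by rewrite iter_jump_genN mulrN.
Qed.

(** Pascal's rule, in the form of the induction step for expanding powers of [A + c]; [a i] stands
    for the [i]-th iterate of [A]. *)
Lemma binomial_pascal (a : nat -> R) c k :
  \sum_(i < k.+2) 'C(k.+1, i)%:R * c ^+ (k.+1 - i)%N * a i =
  \sum_(i < k.+1) 'C(k, i)%:R * c ^+ (k - i)%N * a i.+1 +
  c * \sum_(i < k.+1) 'C(k, i)%:R * c ^+ (k - i)%N * a i.
Proof.
rewrite big_ord_recl /= subn0 bin0 mul1r.
under eq_bigr => i _ do rewrite /bump /= add1n subSS binS natrD 2!mulrDl.
rewrite big_split /= addrA [RHS]addrC; congr (_ + _).
rewrite big_ord_recr /= bin_small // !mul0r addr0.
rewrite [in RHS]big_ord_recl /= subn0 bin0 mul1r mulrDr exprS mulrA.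
congr (_ + _); rewrite mulr_sumr; apply: eq_bigr => i _.
by rewrite /bump /= add1n -(subnSK (ltn_ord i)) exprS; ring.
Qed.

Lemma iter_jump_gen_shift c f k x :
  iter k (fun g y => A g y + c * g y) f x =
  \sum_(i < k.+1) 'C(k, i)%:R * c ^+ (k - i)%N * iter i A f x.
Proof.
elim: k f x => [|k IH] f x.
  by rewrite big_ord1 /= bin0 subn0 expr0 !mul1r.
rewrite iterSr IH.
rewrite (binomial_pascal (fun i => iter i A f x)) mulr_sumr -big_split /=.
by apply: eq_bigr => i _; rewrite iter_jump_genD -iterSr iterS; ring.
Qed.

(** Since [A] commutes with the scalar [c], the binomial expansion turns the series of [A + c] into
    the Cauchy product of the series of [expR (c * t)] and of [exp_gen]. *)
Lemma cvg_exp_gen_shift c t f x : 0 <= c -> 0 <= t ->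
  (fun n => \sum_(k < n) t ^+ k / k`!%:R *
     iter k (fun g y => A g y + c * g y) f x) @ \oo -->
  expR (c * t) * exp_gen r s t f x.
Proof.
move=> c0 t0.
have := @cvg_cauchy_product_exp R (c * t) (t * M) (\sum_y `|f y|)
  (term t f x) (exp_gen r s t f x) (mulr_ge0 c0 t0) (mulr_ge0 t0 M_ge0)
  (fun k => norm_exp_gen_term t f x k t0) (cvg_exp_gen t f x t0).
rewrite (_ : (fun n => \sum_(k < n) \sum_(i < k.+1) _) = (fun n =>
  \sum_(k < n) t ^+ k / k`!%:R * iter k (fun g y => A g y + c * g y) f x)) //.
apply/funext => n; apply: eq_bigr => k _.
rewrite iter_jump_gen_shift mulr_sumr; apply: eq_bigr => i _.
have ik : (i <= k)%N by rewrite -ltnS.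
have fn0 m : m`!%:R != 0 :> R by rewrite pnatr_eq0 -lt0n fact_gt0.
have b0 : ('C(k, i))%:R != 0 :> R by rewrite pnatr_eq0 -lt0n bin_gt0.
rewrite /term /exp_coeff /= exprMn -(bin_fact ik) !natrM.
have -> : t ^+ k = t ^+ (k - i)%N * t ^+ i by rewrite -exprD subnK.
by field; rewrite !fn0 b0.
Qed.

(** A Gronwall estimate: [B = A + c] is monotone on the closed class [E] and satisfies
    [B F <= (c - kap) F] there. Iterating, summing the series and cancelling [expR (c * t)] gives
    the bound. *)
Lemma exp_gen_contraction (E : T -> Prop) (F : T -> R) (kap t : R) :
  0 <= t -> (forall x i, 0 <= r x i) ->
  (forall x i, E x -> r x i != 0 -> E (s x i)) ->
  (forall x, E x -> A F x <= - kap * F x) ->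
  forall x, E x -> exp_gen r s t F x <= expR (- kap * t) * F x.
Proof.
move=> t0 r0 closedE AF x0 Ex0.
(* The sum dominates every exit rate, which makes the diagonal coefficients of [B] nonnegative; the
   term in [kap] makes [c - kap] nonnegative, so its powers preserve inequalities. *)
pose c := `|kap| + \sum_x \sum_i r x i.
have rc x : \sum_i r x i <= c.
  rewrite /c (bigD1 x) //= addrCA lerDl addr_ge0 //.
  by apply: sumr_ge0 => y _; exact: sumr_ge0.
have c0 : 0 <= c by apply: le_trans (rc x0); exact: sumr_ge0.
have ckap : 0 <= c - kap.
  rewrite subr_ge0 (le_trans (ler_norm kap))// lerDl.
  by apply: sumr_ge0 => y _; exact: sumr_ge0.
pose B g y := A g y + c * g y.
have BE g y : B g y = \sum_i r y i * g (s y i) + (c - \sum_i r y i) * g y.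
  rewrite /B /jump_gen; under eq_bigr do rewrite mulrBr.
  by rewrite sumrB -mulr_suml; ring.
have Bmono u v : (forall y, E y -> u y <= v y) ->
    forall y, E y -> B u y <= B v y.
  move=> uv y Ey; rewrite !BE lerD//; last first.
    by rewrite ler_wpM2l ?uv// subr_ge0.
  apply: ler_sum => i _; have [->|ri] := eqVneq (r y i) 0.
    by rewrite !mul0r.
  by rewrite ler_wpM2l// uv//; exact: closedE.
have BF k y : E y -> iter k B F y <= (c - kap) ^+ k * F y.
  elim: k y => [|k IH] y Ey; first by rewrite mul1r.
  rewrite iterS; apply: le_trans (Bmono _ _ IH _ Ey) _.
  have -> : B (fun y => (c - kap) ^+ k * F y) y = (c - kap) ^+ k * B F y.
    rewrite !BE mulrDr mulr_sumr; congr (_ + _); last by ring.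
    by apply: eq_bigr => i _; ring.
  rewrite exprSr -mulrA ler_wpM2l ?exprn_ge0//.
  by rewrite /B; have := AF y Ey; lra.
have lim1 := cvg_exp_gen_shift c t F x0 c0 t0.
have lim2 : (fun n => (\sum_(k < n) exp_coeff (t * (c - kap)) k) * F x0) @ \oo
    --> expR (t * (c - kap)) * F x0.
  by apply: cvgM; [exact: cvg_exp_coeff_sum | exact: cvg_cst].
have : expR (c * t) * exp_gen r s t F x0 <= expR (t * (c - kap)) * F x0.
  apply: ler_cvg_to lim1 lim2 _; apply: nearW => n.
  rewrite mulr_suml; apply: ler_sum => k _.
  rewrite /exp_coeff /= exprMn [X in _ <= X](_ : _ =
    t ^+ k / k`!%:R * ((c - kap) ^+ k * F x0)); last by ring.
  rewrite ler_wpM2l ?BF//.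
  by rewrite divr_ge0 ?exprn_ge0.
rewrite (_ : t * (c - kap) = c * t + - kap * t); last by ring.
by rewrite expRD -mulrA ler_pM2l ?expR_gt0.
Qed.

Hypothesis r_ge0 : forall x i, 0 <= r x i.

Lemma exp_gen_ge0 t f x : 0 <= t -> (forall y, 0 <= f y) ->
  0 <= exp_gen r s t f x.
Proof.
move=> t0 f0; rewrite -oppr_le0 -exp_genN//.
(* The contraction estimate is applied to [- f] on the whole space, with decay rate the total rate
   [c]: the chain stays at [x] up to time [t] with probability at least [expR (- c * t)]. *)
pose c := \sum_x \sum_i r x i.
apply: (@le_trans _ _ (expR (- c * t) * - f x)); last first.
  by rewrite mulrN oppr_le0 mulr_ge0 ?expR_ge0.
apply: (@exp_gen_contraction (fun=> True)) => // y _.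
rewrite mulrNN /jump_gen /c; apply: (@le_trans _ _ ((\sum_i r y i) * f y)).
  rewrite mulr_suml; apply: ler_sum => i _.
  rewrite ler_wpM2l//; have := f0 (s y i); lra.
rewrite ler_wpM2r// (bigD1 y) //= lerDl.
by apply: sumr_ge0 => z _; exact: sumr_ge0.
Qed.

Lemma exp_gen1 t x : 0 <= t -> exp_gen r s t (fun=> 1) x = 1.
Proof.
have A1 k y : iter k.+1 A (fun=> 1) y = 0.
  elim: k y => [|k IH] y; rewrite iterS /jump_gen big1// => i _.
    by rewrite subrr mulr0.
  by rewrite !IH subrr mulr0.
move=> t0; apply: exp_genE; apply: cvg_near_cst.
(* The partial sums equal 1 only from index 1 on; the empty sum at index 0 is 0. *)
exists 1%N => // -[//|n] _.
rewrite big_ord_recl /= expr0 fact0 divr1 mul1r big1 ?addr0// => i _.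
by have := A1 i x; rewrite /= => ->; rewrite mulr0.
Qed.

End JumpGenerator.

(** If composition with [p] intertwines the generators, it intertwines all their powers, hence the
    two series term by term. *)
Lemma exp_gen_intertwine {R : realType} {T I T' I' : finType}
    (r : T -> I -> R) (s : T -> I -> T) (r' : T' -> I' -> R)
    (s' : T' -> I' -> T') (p : T' -> T) t f x :
  (forall g y, jump_gen r' s' (g \o p) y = jump_gen r s g (p y)) ->
  exp_gen r' s' t (f \o p) x = exp_gen r s t f (p x).
Proof.
move=> H; rewrite /exp_gen.
suff E k y : iter k (jump_gen r' s') (f \o p) y =
    iter k (jump_gen r s) f (p y).
  by congr (limn (series _)); apply/funext => k; rewrite E.
elim: k y => [//|k IH] y /=.
by rewrite -H; congr (jump_gen _ _ _ y); apply/funext => z; exact: IH.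
Qed.

(** * Gluing and mixing of couplings *)

Lemma sum_indicator {R : pzRingType} {T : finType} (u : T -> R) (x : T) :
  \sum_y u y * (x == y)%:R = u x.
Proof.
rewrite (bigD1 x) //= eqxx mulr1 big1 ?addr0// => y yx.
by rewrite eq_sym (negPf yx) mulr0.
Qed.

Lemma sum_pairE {R : nmodType} {T U : finType} (F : T * U -> R) :
  \sum_p F p = \sum_x \sum_y F (x, y).
Proof. by rewrite pair_big; apply: eq_bigr => -[]. Qed.

Section Transport.
Context {R : realType} {T : finType} (cost : T * T -> R).
Implicit Types (nu eta : T -> R) (w : R).

(** Asking for one coupling of cost at most [w], instead of bounding an infimum, lets couplings be
    glued and mixed without minimisers. *)
Definition transport_le nu eta w : Prop :=
  exists2 g, is_coupling nu eta g & \sum_p cost p * g p <= w.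

Lemma coupling_ge0 nu eta g : is_coupling nu eta g -> forall p, 0 <= g p.
Proof. by case=> -[]. Qed.

Lemma is_pmf_pair (g : T * T -> R) nu : (forall p, 0 <= g p) ->
  (forall x, \sum_y g (x, y) = nu x) -> \sum_x nu x = 1 -> is_pmf g.
Proof.
move=> g0 gnu nu1; split=> //; rewrite -nu1.
under [RHS]eq_bigr do rewrite -gnu.
exact: sum_pairE.
Qed.

Lemma coupling_mass1 nu eta g : is_coupling nu eta g -> \sum_x nu x = 1.
Proof.
case=> -[_ <-] gnu _; under eq_bigr do rewrite -gnu.
exact/esym/sum_pairE.
Qed.

(** Gluing: given the middle point [y], the two outer points are drawn independently, and the
    triangle inequality is integrated over the triples. *)
Lemma transport_le_trans mu nu eta v w :
  (forall p, 0 <= cost p) ->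
  (forall x y z, cost (x, z) <= cost (x, y) + cost (y, z)) ->
  transport_le mu nu v -> transport_le nu eta w ->
  transport_le mu eta (v + w).
Proof.
move=> c0 ctri [g1 cg1 le1] [g2 cg2 le2].
have g1_0 := coupling_ge0 _ _ _ cg1; have g2_0 := coupling_ge0 _ _ _ cg2.
have mu1 := coupling_mass1 _ _ _ cg1.
case: cg1 => _ g1l g1r; case: cg2 => _ g2l g2r.
have nu0 y : 0 <= nu y by rewrite -g1r sumr_ge0.
(* Where [nu y] vanishes the quotient is 0 by convention, and so is [g1 (x, y)], being a term of a
   vanishing sum of nonnegative terms. *)
have g1K x y : g1 (x, y) / nu y * nu y = g1 (x, y).
  have [ny|ny] := eqVneq (nu y) 0; last by rewrite divfK.
  rewrite ny mulr0; apply/esym/eqP; move/eqP: (ny).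
  rewrite -g1r psumr_eq0; last by move=> *; exact: g1_0.
  by move/allP => /(_ x); rewrite mem_index_enum => /(_ isT).
have g2K y z : g2 (y, z) / nu y * nu y = g2 (y, z).
  have [ny|ny] := eqVneq (nu y) 0; last by rewrite divfK.
  rewrite ny mulr0; apply/esym/eqP; move/eqP: (ny).
  rewrite -g2l psumr_eq0; last by move=> *; exact: g2_0.
  by move/allP => /(_ z); rewrite mem_index_enum => /(_ isT).
pose g p := \sum_y g1 (p.1, y) * g2 (y, p.2) / nu y.
have gl x : \sum_z g (x, z) = mu x.
  rewrite exchange_big /= -g1l; apply: eq_bigr => y _.
  by rewrite -mulr_suml -mulr_sumr g2l -mulrA mulrCA mulrC g1K.
have gr z : \sum_x g (x, z) = eta z.
  rewrite exchange_big /= -g2r; apply: eq_bigr => y _.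
  by rewrite -mulr_suml -mulr_suml g1r -mulrA mulrC g2K.
have g0 p : 0 <= g p.
  by apply: sumr_ge0 => y _; rewrite divr_ge0// mulr_ge0.
exists g; first by split=> //; exact: is_pmf_pair gl mu1.
apply: le_trans (lerD le1 le2).
rewrite !sum_pairE.
(* Both costs become sums over triples with the same weight, so that the triangle inequality can be
   used pointwise. *)
have -> : \sum_x \sum_y cost (x, y) * g1 (x, y) =
    \sum_x \sum_z \sum_y cost (x, y) * (g1 (x, y) * g2 (y, z) / nu y).
  apply: eq_bigr => x _; rewrite exchange_big /=; apply: eq_bigr => y _.
  rewrite -mulr_sumr -mulr_suml -mulr_sumr g2l.
  by rewrite -[g1 (x, y) * _ / _]mulrAC g1K.
have -> : \sum_x \sum_y cost (x, y) * g2 (x, y) =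
    \sum_x \sum_z \sum_y cost (y, z) * (g1 (x, y) * g2 (y, z) / nu y).
  under [RHS]eq_bigr do rewrite exchange_big.
  rewrite [RHS]exchange_big /=; apply: eq_bigr => y _.
  rewrite [RHS]exchange_big /=; apply: eq_bigr => z _.
  rewrite -mulr_sumr -mulr_suml -mulr_suml g1r.
  by rewrite [nu y * _]mulrC mulrAC g2K.
rewrite -big_split; apply: ler_sum => x _.
rewrite -big_split; apply: ler_sum => z _.
rewrite -big_split /= mulr_sumr; apply: ler_sum => y _.
by rewrite -mulrDl ler_wpM2r ?ctri// divr_ge0// mulr_ge0.
Qed.

(** A coupling [G p] of the two kernels is chosen for each pair [p] of starting points, and these
    are averaged with the weights [g]. *)
Lemma transport_le_mix (P : T -> T -> R) (w : T * T -> R) nu eta g :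
  (forall x y, transport_le (P x) (P y) (w (x, y))) ->
  is_coupling nu eta g ->
  transport_le (fun z => \sum_x nu x * P x z) (fun z => \sum_x eta x * P x z)
    (\sum_p w p * g p).
Proof.
move=> H cg.
have /choice [G HG] p : exists G, is_coupling (P p.1) (P p.2) G /\
    \sum_q cost q * G q <= w p.
  by case: p => x y; have [G] := H x y; exists G.
have G0 p q : 0 <= G p q by exact: (coupling_ge0 _ _ _ (HG p).1).
have P1 (p : T * T) : \sum_z P p.1 z = 1.
  by exact: (coupling_mass1 _ _ _ (HG p).1).
have g0 := coupling_ge0 _ _ _ cg.
have nu1 := coupling_mass1 _ _ _ cg.
have [_ gl gr] := cg.
pose g' q := \sum_p g p * G p q.
have g'l u : \sum_v g' (u, v) = \sum_x nu x * P x u.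
  rewrite exchange_big sum_pairE; apply: eq_bigr => x _.
  rewrite -gl mulr_suml; apply: eq_bigr => y _.
  by have [[_ <- _] _] := HG (x, y); rewrite mulr_sumr.
have g'r v : \sum_u g' (u, v) = \sum_x eta x * P x v.
  rewrite exchange_big sum_pairE exchange_big /=; apply: eq_bigr => y _.
  rewrite -gr mulr_suml; apply: eq_bigr => x _.
  by have [[_ _ <-] _] := HG (x, y); rewrite mulr_sumr.
exists g'.
  split=> //; apply: is_pmf_pair g'l _.
    by move=> q; apply: sumr_ge0 => p _; rewrite mulr_ge0.
  rewrite exchange_big -nu1; apply: eq_bigr => x _.
  by rewrite -mulr_sumr (P1 (x, x)) mulr1.
under eq_bigr do rewrite mulr_sumr.
rewrite exchange_big /=; apply: ler_sum => p _.
under eq_bigr do rewrite mulrCA.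
by rewrite -mulr_sumr mulrC ler_wpM2r// (HG p).2.
Qed.

End Transport.

(** * Couplings obtained from a Markov chain on pairs *)

Section PairChain.
Context {R : realType} {T I J : finType} (r : T -> I -> R) (s : T -> I -> T).
Context (m : T * T -> J -> R) (sp : T * T -> J -> T * T).
Hypothesis m_ge0 : forall p e, 0 <= m p e.
Hypothesis m_fst : forall f p,
  jump_gen m sp (f \o fst) p = jump_gen r s f p.1.
Hypothesis m_snd : forall f p,
  jump_gen m sp (f \o snd) p = jump_gen r s f p.2.

(** The coupling is the law at time [t] of the pair chain started at [(x, y)]; its marginals are
    right by intertwining with the two projections, and its cost is the expected cost. *)
Lemma exp_gen_transport (cost : T * T -> R) t x y : 0 <= t ->
  transport_le cost
    (fun u => exp_gen r s t (fun z => (z == u)%:R) x)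
    (fun v => exp_gen r s t (fun z => (z == v)%:R) y)
    (exp_gen m sp t cost (x, y)).
Proof.
move=> t0; pose g q := exp_gen m sp t (fun p => (p == q)%:R) (x, y).
have gE F : \sum_q F q * g q = exp_gen m sp t F (x, y).
  rewrite -exp_gen_sum//; congr (exp_gen _ _ _ _ _); apply/funext => p.
  exact: sum_indicator.
have g0 q : 0 <= g q by apply: exp_gen_ge0.
exists g; last by rewrite gE.
split.
- split=> //; have := gE (fun=> 1); rewrite exp_gen1// => <-.
  by apply: eq_bigr => q _; rewrite mul1r.
- move=> u; rewrite -(exp_gen_intertwine r s m sp fst t _ (x, y)) ?m_fst//.
  rewrite -gE [RHS]sum_pairE [RHS](bigD1 u) //= eqxx.
  under [X in _ = X + _]eq_bigr do rewrite mul1r.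
  rewrite [X in _ + X]big1 ?addr0// => z /negPf zu; rewrite big1// => v _.
  by rewrite /= zu mul0r.
- move=> v; rewrite -(exp_gen_intertwine r s m sp snd t _ (x, y)) ?m_snd//.
  rewrite -gE [RHS]sum_pairE [RHS]exchange_big [RHS](bigD1 v) //= eqxx.
  under [X in _ = X + _]eq_bigr do rewrite mul1r.
  rewrite [X in _ + X]big1 ?addr0// => z /negPf zv; rewrite big1// => u _.
  by rewrite /= zv mul0r.
Qed.

End PairChain.

(** * The coupling of adjacent points *)

Definition opp_move {d : nat} (a : 'I_d * bool) : 'I_d * bool := (a.1, ~~ a.2).

Lemma opp_moveK {d : nat} : involutive (@opp_move d).
Proof. by case=> j b; rewrite /opp_move negbK. Qed.

Lemma opp_move_neq {d : nat} (a : 'I_d * bool) : opp_move a != a.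
Proof. by case: a => j []; rewrite /opp_move xpair_eqE andbF. Qed.

Lemma move_axisE {d : nat} (a b : 'I_d * bool) :
  (b.1 != a.1) = (b != opp_move a) && (b != a).
Proof.
case: a b => [i x] [j y]; rewrite /opp_move !xpair_eqE /=.
by case: eqP; case: x; case: y.
Qed.

Section Balance.
Context {R : realDomainType} {d : nat}.
Local Notation I := ('I_d * bool)%type.
Implicit Types (c phi : I -> R) (g a : I).

(** This is [kappa] with the rates at a point and at its neighbour in direction [g] as abstract
    vectors [c1] and [c2]. *)
Definition meeting_rate c1 c2 g : R :=
  c1 g - c2 g - \sum_(a | a.1 != g.1) Num.max (c2 a - c1 a) 0.

Lemma meeting_rate_le c1 c2 g : 0 <= meeting_rate c1 c2 g -> c2 g <= c1 g.
Proof.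
rewrite /meeting_rate subr_ge0 => H; rewrite -subr_ge0; apply: le_trans H.
by apply: sumr_ge0 => a _; rewrite le_max lexx orbT.
Qed.

(** The marginal condition for the first point: common moves, its own excess moves, and the steps
    [g] that accompany excess moves of the neighbour add up to [c1]. The sum subtracted in
    [meeting_rate] is the rate of these accompanying steps. *)
Lemma meeting_rate_balance c1 c2 g phi :
  c2 g <= c1 g -> c1 (opp_move g) <= c2 (opp_move g) ->
  \sum_a Num.min (c1 a) (c2 a) * phi a +
  \sum_a (if a == g then meeting_rate c1 c2 g
          else Num.max (c1 a - c2 a) 0) * phi a +
  (\sum_(a | a != opp_move g) Num.max (c2 a - c1 a) 0) * phi g =
  \sum_a c1 a * phi a.
Proof.
move=> cg cg'.
rewrite (bigD1 g) //= [X in _ + X + _](bigD1 g) //= [RHS](bigD1 g) //= eqxx.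
(* The neighbour has no excess along [g], so only the other axes contribute. *)
rewrite (min_r cg) (_ : \sum_(a | a != opp_move g) _ =
    \sum_(a | a.1 != g.1) Num.max (c2 a - c1 a) 0); last first.
  rewrite (bigD1 g) /=; last by rewrite eq_sym opp_move_neq.
  rewrite max_r ?subr_le0// add0r; apply: eq_bigl => a.
  by rewrite move_axisE.
have -> : \sum_(a | a != g) c1 a * phi a =
    \sum_(a | a != g) Num.min (c1 a) (c2 a) * phi a +
    \sum_(a | a != g) (if a == g then meeting_rate c1 c2 g
          else Num.max (c1 a - c2 a) 0) * phi a.
  rewrite -big_split; apply: eq_bigr => a /negPf -> /=.
  rewrite -mulrDl; congr (_ * _).
  by case: (leP (c1 a) (c2 a)) => c12; case: leP; lra.
by rewrite /meeting_rate; ring.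
Qed.

End Balance.

Section Coupling.
Context {R : realType} {d : nat} (h : R).
Hypothesis h_gt0 : 0 < h.
Local Notation I := ('I_d * bool)%type.
Local Notation opp := opp_move.

Lemma step_oppK (a : I) (x : 'rV[R]_d) : step h (opp a) (step h a x) = x.
Proof. by case: a => j []; rewrite /step /= ?addrK ?subrK. Qed.

Lemma stepC (a b : I) (x : 'rV[R]_d) :
  step h a (step h b x) = step h b (step h a x).
Proof. by rewrite /step; case: a.2; case: b.2; rewrite addrAC. Qed.

Definition l1_dist (x y : 'rV[R]_d) : R := \sum_j `|x 0 j - y 0 j|.

Lemma l1_distxx x : l1_dist x x = 0.
Proof. by rewrite /l1_dist big1// => j _; rewrite subrr normr0. Qed.

Lemma l1_dist_step (a : I) (x : 'rV[R]_d) : l1_dist x (step h a x) = h.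
Proof.
rewrite /l1_dist (bigD1 a.1) //= big1 => [|j /negPf ja].
  rewrite addr0 /step; case: ifP => _; rewrite !mxE !eqxx mulr1.
    by rewrite opprD addNKr normrN gtr0_norm.
  by rewrite opprB addrC subrK gtr0_norm.
rewrite /step; case: ifP => _; rewrite !mxE !eqxx ja mulr0.
  by rewrite addr0 subrr normr0.
by rewrite subr0 subrr normr0.
Qed.

Context (G : {fset 'rV[R]_d}) (r : G -> I -> R).

Definition grid_step (x : G) (a : I) : G := insubd x (step h a (val x)).
Local Notation s := grid_step.

Hypothesis r_ge0 : forall x a, 0 <= r x a.
Hypothesis r_grid : forall x a, r x a != 0 -> step h a (val x) \in G.
Hypothesis meeting_rate_gt0 : forall (x y : G) a,
  val y = step h a (val x) -> 0 < meeting_rate (r x) (r y) a.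

Lemma rate_neq0_step x a : r x a != 0 -> val (s x a) = step h a (val x).
Proof. by move=> /r_grid xG; rewrite /grid_step insubdK. Qed.

Lemma grid_stepE (x y : G) a : val y = step h a (val x) -> s x a = y.
Proof. by move=> xy; rewrite /grid_step -xy valKd. Qed.

Definition adjacent (x y : G) : option I :=
  [pick a | val y == step h a (val x)].

Variant adjacent_spec (x y : G) : option I -> Type :=
  | AdjacentSome a of val y = step h a (val x)
      & val x = step h (opp a) (val y) :
      adjacent_spec x y (Some a)
  | AdjacentNone of (forall a, val y <> step h a (val x)) :
      adjacent_spec x y None.

Lemma adjacentP x y : adjacent_spec x y (adjacent x y).
Proof.
rewrite /adjacent; case: pickP => [a /eqP H|H].
  by constructor=> //; rewrite H step_oppK.
by constructor => a /eqP; rewrite H.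
Qed.

(* For adjacent x and y = step g x, the event [inl a] moves both points by [a];
   [inr (inl a)] is the excess rate of x and [inr (inr a)] that of y. The excess
   moves of x off the axis of g are matched with y stepping back onto x, and
   those of y with x stepping onto y, so that the pair stays adjacent; what
   remains of the moves [g] of x and [opp g] of y makes the pair meet. *)
Definition event : finType := (I + (I + I))%type.

Definition event_rate (p : G * G) (e : event) : R :=
  match e, adjacent p.1 p.2 with
  | inl a, _ => Num.min (r p.1 a) (r p.2 a)
  | inr (inl a), Some g => if a == g then meeting_rate (r p.1) (r p.2) g
                           else Num.max (r p.1 a - r p.2 a) 0
  | inr (inl a), None => Num.max (r p.1 a - r p.2 a) 0
  | inr (inr a), Some g => if a == opp g
                           then meeting_rate (r p.2) (r p.1) (opp g)
                           else Num.max (r p.2 a - r p.1 a) 0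
  | inr (inr a), None => Num.max (r p.2 a - r p.1 a) 0
  end.

Definition event_jump (p : G * G) (e : event) : G * G :=
  match e, adjacent p.1 p.2 with
  | inl a, _ => (s p.1 a, s p.2 a)
  | inr (inl a), Some g => (s p.1 a, if a == g then p.2 else s p.2 (opp g))
  | inr (inl a), None => (s p.1 a, p.2)
  | inr (inr a), Some g => (if a == opp g then p.1 else s p.1 g, s p.2 a)
  | inr (inr a), None => (p.1, s p.2 a)
  end.

Lemma event_rate_ge0 p e : 0 <= event_rate p e.
Proof.
have max0 (u : R) : 0 <= Num.max u 0 by rewrite le_max lexx orbT.
rewrite /event_rate; case: e => [a|[a|a]].
- by rewrite le_min !r_ge0.
- case: adjacentP => [g xy yx|_]; last exact: max0.
  by case: ifP => _; [exact/ltW/meeting_rate_gt0 | exact: max0].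
- case: adjacentP => [g xy yx|_]; last exact: max0.
  by case: ifP => _; [exact/ltW/meeting_rate_gt0 | exact: max0].
Qed.

Lemma event_gen_fst f p :
  jump_gen event_rate event_jump (f \o fst) p = jump_gen r s f p.1.
Proof.
rewrite /jump_gen !big_sumType /= /event_rate /event_jump.
case: adjacentP => [g xy yx|_] /=; last first.
  have zero (u : I -> R) : \sum_a u a * (f p.1 - f p.1) = 0.
    by rewrite -mulr_suml subrr mulr0.
  rewrite zero addr0.
  rewrite -big_split; apply: eq_bigr => a _ /=; rewrite -mulrDl; congr (_ * _).
  by case: (leP (r p.1 a) (r p.2 a)) => c12; case: leP; lra.
have le1 := meeting_rate_le _ _ _ (ltW (meeting_rate_gt0 _ _ _ xy)).
have le2 := meeting_rate_le _ _ _ (ltW (meeting_rate_gt0 _ _ _ yx)).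
rewrite -(meeting_rate_balance _ _ g _ le1 le2) addrA; congr (_ + _ + _).
(* The event in which the second point steps back onto the first leaves the first in place; every
   other excess event of the second moves the first by [g]. *)
rewrite [LHS](bigD1 (opp g)) //= eqxx subrr mulr0 add0r mulr_suml.
by apply: eq_bigr => a /negPf ->.
Qed.

Lemma event_gen_snd f p :
  jump_gen event_rate event_jump (f \o snd) p = jump_gen r s f p.2.
Proof.
rewrite /jump_gen !big_sumType /= /event_rate /event_jump.
case: adjacentP => [g xy yx|_] /=; last first.
  have zero (u : I -> R) : \sum_a u a * (f p.2 - f p.2) = 0.
    by rewrite -mulr_suml subrr mulr0.
  rewrite zero add0r.
  rewrite -big_split; apply: eq_bigr => a _ /=; rewrite -mulrDl; congr (_ * _).
  by case: (leP (r p.1 a) (r p.2 a)) => c12; case: leP; lra.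
have le1 := meeting_rate_le _ _ _ (ltW (meeting_rate_gt0 _ _ _ xy)).
have le2 := meeting_rate_le _ _ _ (ltW (meeting_rate_gt0 _ _ _ yx)).
(* The same balance with the two points exchanged, hence with [g] replaced by its opposite. *)
have := meeting_rate_balance (r p.2) (r p.1) (opp g)
  (fun a => f (s p.2 a) - f p.2).
rewrite opp_moveK => /(_ le2 le1) <-.
rewrite [X in _ + X]addrC addrA; congr (_ + _ + _).
  by under eq_bigr do rewrite minC.
rewrite [LHS](bigD1 g) //= eqxx subrr mulr0 add0r mulr_suml.
by apply: eq_bigr => a /negPf ->.
Qed.

Definition adjacent_or_eq (p : G * G) : Prop :=
  p.1 = p.2 \/ exists a, val p.2 = step h a (val p.1).

Lemma adjacent_fwd x a : r x a != 0 -> adjacent_or_eq (x, s x a).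
Proof. by move=> /rate_neq0_step H; right; exists a. Qed.

Lemma adjacent_bwd x a : r x a != 0 -> adjacent_or_eq (s x a, x).
Proof.
by move=> /rate_neq0_step H; right; exists (opp a); rewrite /= H step_oppK.
Qed.

(** Common moves translate the pair; any other event either makes it meet or puts one point onto the
    former position of the other. A nonzero common or excess rate forces a nonzero rate of the move
    itself, so [grid_step] is then a true step. *)
Lemma event_jump_closed p e : adjacent_or_eq p -> event_rate p e != 0 ->
  adjacent_or_eq (event_jump p e).
Proof.
case: p => x y Exy; have r0 := r_ge0.
have minP a : Num.min (r x a) (r y a) != 0 -> r x a != 0 /\ r y a != 0.
  move=> H; split; apply: contra_neq H => H.
    by rewrite H min_l// r0.
  by rewrite H min_r// r0.
have maxP (u v : R) : 0 <= u -> 0 <= v -> Num.max (u - v) 0 != 0 -> u != 0.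
  move=> u0 v0; apply: contra_neq => ->.
  by rewrite max_r// sub0r oppr_le0.
rewrite /event_rate /event_jump /=; case: adjacentP => [g xy yx|noadj].
- case: e => [a /minP[rx ry]|[a|a]].
  + right; exists g => /=.
    by rewrite (rate_neq0_step _ _ rx) (rate_neq0_step _ _ ry) xy stepC.
  + case: (a =P g) => [-> _|_ rx].
      by left; rewrite /= (grid_stepE _ _ _ xy).
    rewrite (grid_stepE _ _ _ yx); apply: adjacent_bwd.
    by apply: (maxP _ (r y a)).
  + case: (a =P opp g) => [-> _|_ ry].
      by left; rewrite /= (grid_stepE _ _ _ yx).
    rewrite (grid_stepE _ _ _ xy); apply: adjacent_fwd.
    by apply: (maxP _ (r x a)).
(* Equal points have equal rates, so only common moves occur. *)
- case: Exy => [/= xy|[a /noadj//]]; rewrite -{}xy.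
  case: e => [a|[a|a]]; first by left.
    by rewrite subrr maxxx eqxx.
  by rewrite subrr maxxx eqxx.
Qed.

Definition pair_dist (p : G * G) : R := l1_dist (val p.1) (val p.2).

Lemma pair_dist_ge0 p : 0 <= pair_dist p.
Proof. by apply: sumr_ge0 => j _. Qed.

Lemma pair_dist_le p : adjacent_or_eq p -> pair_dist p <= h.
Proof.
rewrite /pair_dist; case=> [->|[a ->]]; first by rewrite l1_distxx ltW.
by rewrite l1_dist_step.
Qed.

Context (kap : R).
Hypothesis kap_le : forall (x y : G) a, val y = step h a (val x) ->
  kap <= meeting_rate (r x) (r y) a + meeting_rate (r y) (r x) (opp a).

Lemma event_gen_dist p : adjacent_or_eq p ->
  jump_gen event_rate event_jump pair_dist p <=
  - kap * pair_dist p.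
Proof.
case: p => x y Ep; have closed := event_jump_closed (x, y) ^~ Ep.
rewrite /jump_gen; case xyE: (adjacent x y) => [g|]; last first.
  have {Ep}xy : x = y.
    by case: Ep => // -[a]; move: xyE; case: adjacentP => // noadj _ /noadj.
  rewrite -{}xy in xyE closed *.
  have p0 : pair_dist (x, x) = 0 by rewrite /pair_dist l1_distxx.
  rewrite p0 mulr0 big1// => e _; rewrite /event_rate /event_jump /= xyE.
  case: e => [a|[a|a]]; rewrite ?subrr ?maxxx ?mul0r//.
  by rewrite /pair_dist l1_distxx subrr mulr0.
have [xy yx] : val y = step h g (val x) /\ val x = step h (opp g) (val y).
  by move: xyE; case: adjacentP => // a xy yx [<-].
have ph : pair_dist (x, y) = h by rewrite /pair_dist xy l1_dist_step.
pose el : event := inr (inl g); pose er : event := inr (inr (opp g)).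
(* Only the two meeting events are kept, each lowering the distance from [h] to 0; any other
   possible event leads to a distance at most [h], so its contribution is nonpositive. *)
apply: (@le_trans _ _ (\sum_e (event_rate (x, y) e * (el == e)%:R * - h +
    event_rate (x, y) e * (er == e)%:R * - h))).
  apply: ler_sum => e _; rewrite ph.
  have [<-|ne_l] := eqVneq el e.
    rewrite mulr1 mulr0 mul0r addr0 /event_jump /= xyE eqxx.
    by rewrite (grid_stepE _ _ _ xy) {1}/pair_dist l1_distxx sub0r.
  have [<-|ne_r] := eqVneq er e.
    rewrite mulr1 mulr0 mul0r add0r /event_jump /= xyE eqxx.
    by rewrite (grid_stepE _ _ _ yx) {1}/pair_dist l1_distxx sub0r.
  rewrite !mulr0 !mul0r addr0.
  have [->|e0] := eqVneq (event_rate (x, y) e) 0; first by rewrite mul0r.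
  rewrite mulr_ge0_le0 ?event_rate_ge0// subr_le0.
  by apply: pair_dist_le; exact: closed.
rewrite big_split -!mulr_suml !sum_indicator ph /event_rate /= xyE !eqxx.
by rewrite -mulrDl mulrN mulNr lerN2 ler_pM2r// kap_le.
Qed.

End Coupling.

(** * Distances and paths in the grid *)

Section Norms.
Context {R : realType} {d : nat}.
Implicit Types x y z : 'rV[R]_d.

Lemma l1_dist_triangle x y z : l1_dist x z <= l1_dist x y + l1_dist y z.
Proof.
rewrite /l1_dist -big_split; apply: ler_sum => j _ /=.
by rewrite (le_trans _ (ler_normD _ _))// addrA subrK.
Qed.

Lemma eucl_norm_le_l1 x y : eucl_norm (x - y) <= l1_dist x y.
Proof.
have l0 : 0 <= l1_dist x y by exact: sumr_ge0.
rewrite /eucl_norm -[leRHS](ger0_norm l0) -sqrtr_sqr; apply: ler_wsqrtr.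
rewrite expr2 {1}/l1_dist mulr_suml; apply: ler_sum => j _.
rewrite !mxE -real_normK ?num_real// expr2 ler_wpM2l//.
by rewrite /l1_dist (bigD1 j) //= lerDl sumr_ge0.
Qed.

Lemma l1_le_eucl_norm x y : (0 < d)%N ->
  l1_dist x y <= Num.sqrt d%:R * eucl_norm (x - y).
Proof.
move=> d0; have l0 : 0 <= l1_dist x y by exact: sumr_ge0.
rewrite /eucl_norm -sqrtrM ?ler0n// -[leLHS](ger0_norm l0) -sqrtr_sqr.
apply: ler_wsqrtr; set S := l1_dist x y.
have dR : 0 < d%:R :> R by rewrite ltr0n.
(* Cauchy-Schwarz against the constant vector, in the form that a variance is nonnegative. *)
have : 0 <= \sum_j (`|x 0 j - y 0 j| - S / d%:R) ^+ 2.
  by apply: sumr_ge0 => j _; exact: sqr_ge0.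
have -> : \sum_j (`|x 0 j - y 0 j| - S / d%:R) ^+ 2 =
    \sum_j (x - y) 0 j ^+ 2 - S ^+ 2 / d%:R.
  under eq_bigr do rewrite sqrrB real_normK ?num_real//.
  rewrite big_split /= sumrB sumrMnl -mulr_suml -/(l1_dist x y) -/S.
  rewrite sumr_const card_ord -[_ *+ d]mulr_natr.
  under [X in _ = X - _]eq_bigr do rewrite !mxE.
  by field; rewrite gt_eqF.
by rewrite subr_ge0 ler_pdivrMr// mulrC.
Qed.

End Norms.

Section GridPaths.
Context {R : realType} {d : nat} (K h : R) (N : nat).
Hypothesis h_gt0 : 0 < h.
Local Notation G := (grid d K h N).

Lemma mem_grid (x : 'rV[R]_d) : reflect
  (forall j, exists2 k, (k < N)%N & x 0 j = - K + h * k.+1%:R - h / 2)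
  (x \in G).
Proof.
apply: (iffP idP) => [/imfsetP[n _ ->] j|H].
  by exists (n j); rewrite ?mxE.
have /choice[n Hn] j : exists k : 'I_N, x 0 j = - K + h * k.+1%:R - h / 2.
  by have [k kN] := H j; exists (Ordinal kN).
apply/imfsetP; exists [ffun j => n j] => //=.
by apply/rowP => j; rewrite mxE ffunE.
Qed.

Lemma grid_l1_dist (x y : G) :
  exists k : nat, l1_dist (val x) (val y) = k%:R * h.
Proof.
rewrite /l1_dist; apply: (big_ind (fun u => exists k : nat, u = k%:R * h)).
- by exists 0%N; rewrite mul0r.
- by move=> _ _ [k ->] [l ->]; exists (k + l)%N; rewrite natrD mulrDl.
move=> j _; have /mem_grid/(_ j)[k _ ->] := fsvalP x.
have /mem_grid/(_ j)[l _ ->] := fsvalP y.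
(* With truncated subtraction this is the absolute difference of [k] and [l]. *)
exists ((k - l) + (l - k))%N.
rewrite (_ : _ - _ = (k%:R - l%:R) * h); last by rewrite -!natr1; ring.
rewrite normrM (gtr0_norm h_gt0); congr (_ * _).
have [kl|/ltnW kl] := leqP k l.
  by rewrite (eqP (kl : k - l == 0)%N) add0n natrB// ler0_norm ?opprB//
    subr_le0 ler_nat.
by rewrite (eqP (kl : l - k == 0)%N) addn0 natrB// ger0_norm// subr_ge0 ler_nat.
Qed.

Lemma l1_dist_step_axis (x y : 'rV[R]_d) (a : 'I_d * bool) :
  `|step h a x 0 a.1 - y 0 a.1| = `|x 0 a.1 - y 0 a.1| - h ->
  l1_dist (step h a x) y = l1_dist x y - h.
Proof.
move=> H; rewrite /l1_dist (bigD1 a.1) //= [X in _ = X - _](bigD1 a.1) //= H.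
rewrite addrAC; congr (_ + _ - _); apply: eq_bigr => j /negPf ja.
by rewrite /step; case: ifP => _; rewrite !mxE ja /= mulr0 ?addr0 ?subr0.
Qed.

(** A step along a coordinate where the points differ, towards [y]: the new coordinate lies between
    the old ones, so the step stays in the box. *)
Lemma grid_step_towards (x y : G) : x != y ->
  exists a (z : G), val z = step h a (val x) /\
    l1_dist (val z) (val y) = l1_dist (val x) (val y) - h.
Proof.
move=> xy; have [j xyj] : exists j, val x 0 j != val y 0 j.
  apply/existsP; apply: contra_neqT xy => /existsPn H; apply/val_inj/rowP => j.
  by have /negPn/eqP := H j.
have /mem_grid Hx := fsvalP x; have /mem_grid Hy := fsvalP y.
have [k kN xk] := Hx j; have [l lN yl] := Hy j.
have step_mem b k' : (k' < N)%N ->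
    step h (j, b) (val x) 0 j = - K + h * k'.+1%:R - h / 2 ->
    step h (j, b) (val x) \in G.
  move=> k'N E; apply/mem_grid => i; have [->|ij] := eqVneq i j.
    by exists k'.
  have [m mN xm] := Hx i; exists m => //; rewrite -xm /step /=.
  by case: ifP => _; rewrite !mxE (negPf ij) /= mulr0 ?addr0 ?subr0.
have descend b : step h (j, b) (val x) \in G ->
    `|step h (j, b) (val x) 0 j - val y 0 j| = `|val x 0 j - val y 0 j| - h ->
    exists a (z : G), val z = step h a (val x) /\
      l1_dist (val z) (val y) = l1_dist (val x) (val y) - h.
  move=> zG E; exists (j, b), [` zG]%fset; split=> //=.
  exact: (l1_dist_step_axis _ _ (j, b)).
have [kl|lk|kl] := ltngtP k l.
- have E : step h (j, true) (val x) 0 j = - K + h * k.+2%:R - h / 2.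
    by rewrite /step /= !mxE !eqxx mulr1 xk -[k.+2%:R]natr1; ring.
  apply: (descend true); first apply: (step_mem true k.+1) => //.
    exact: leq_ltn_trans lN.
  rewrite E xk yl; move: (h / 2) => c.
  have : k.+1%:R <= l%:R :> R by rewrite ler_nat.
  rewrite -!natr1 -(ler_pM2l h_gt0) !mulrDr !mulr1 => H; have h0 := h_gt0.
  rewrite !ler0_norm; [ring|nra|nra].
- have E : step h (j, false) (val x) 0 j = - K + h * k%:R - h / 2.
    by rewrite /step /= !mxE !eqxx mulr1 xk -[k.+1%:R]natr1; ring.
  case: k kN xk lk E => // k kN xk lk E.
  apply: (descend false); first by apply: (step_mem false k) => //; exact: ltnW.
  rewrite E xk yl; move: (h / 2) => c.
  have : l%:R <= k%:R :> R by rewrite ler_nat.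
  rewrite -!natr1 -(ler_pM2l h_gt0) !mulrDr !mulr1 => H; have h0 := h_gt0.
  rewrite !ger0_norm; [ring|nra|nra].
- by move: xyj; rewrite xk yl kl eqxx.
Qed.

End GridPaths.

(** * Contraction *)

Lemma transport_le_weaken {R : realType} {T : finType} (cost : T * T -> R)
    nu eta v w :
  v <= w -> transport_le cost nu eta v -> transport_le cost nu eta w.
Proof. by move=> vw [g cg gv]; exists g => //; exact: le_trans vw. Qed.

Lemma W1_le {R : realType} {d : nat} (S : {fset 'rV[R]_d}) (nu eta : S -> R) w :
  transport_le (pair_dist S) nu eta w -> W1 nu eta <= w.
Proof.
move=> [g cg gw]; apply: le_trans gw; have g0 := coupling_ge0 _ _ _ cg.
apply: (@le_trans _ _ (\sum_(p : S * S) eucl_norm (val p.1 - val p.2) * g p)).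
  apply: ge_inf; last by exists g.
  exists 0 => _ [g' cg' ->]; apply: sumr_ge0 => p _.
  by rewrite mulr_ge0 ?sqrtr_ge0// (coupling_ge0 _ _ _ cg').
by apply: ler_sum => p _; rewrite ler_wpM2r// eucl_norm_le_l1.
Qed.

(** This makes the set of coupling costs nonempty, as needed to bound the infimum in [W1] from
    below. *)
Lemma coupling_prod {R : realType} {T : finType} (nu eta : T -> R) :
  is_pmf nu -> is_pmf eta -> is_coupling nu eta (fun p => nu p.1 * eta p.2).
Proof.
move=> [nu0 nu1] [eta0 eta1].
have gl x : \sum_y nu x * eta y = nu x by rewrite -mulr_sumr eta1 mulr1.
split=> //= [|y]; last by rewrite -mulr_suml nu1 mul1r.
by apply: (is_pmf_pair _ nu) => // p; rewrite mulr_ge0.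
Qed.

Section Contraction.
Context {R : realType} {d : nat} (K h : R) (N : nat).
Hypotheses (d_gt0 : (0 < d)%N) (h_gt0 : 0 < h).
Local Notation I := ('I_d * bool)%type.
Local Notation G := (grid d K h N).
Context (r : G -> I -> R) (kap : R).
Hypothesis r_ge0 : forall x a, 0 <= r x a.
Hypothesis r_grid : forall x a, r x a != 0 -> step h a (val x) \in G.
Hypothesis meeting_rate_gt0 : forall (x y : G) a,
  val y = step h a (val x) -> 0 < meeting_rate (r x) (r y) a.
Hypothesis kap_le : forall (x y : G) a, val y = step h a (val x) ->
  kap <= meeting_rate (r x) (r y) a + meeting_rate (r y) (r x) (opp_move a).

Let P t (x u : G) := exp_gen r (grid_step h G) t (fun z => (z == u)%:R) x.

Lemma transport_adjacent t (x y : G) : 0 <= t -> adjacent_or_eq h G (x, y) ->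
  transport_le (pair_dist G) (P t x) (P t y)
    (expR (- kap * t) * l1_dist (val x) (val y)).
Proof.
move=> t0 Exy.
have m0 := event_rate_ge0 h G r r_ge0 meeting_rate_gt0.
have mf := event_gen_fst h G r meeting_rate_gt0.
have ms := event_gen_snd h G r meeting_rate_gt0.
apply: transport_le_weaken (exp_gen_transport _ _ _ _ m0 mf ms _ t x y t0).
apply: (exp_gen_contraction _ _ (adjacent_or_eq h G) (pair_dist G)) => //.
- by move=> p e Ep; exact: event_jump_closed.
- by move=> p Ep; exact: event_gen_dist.
Qed.

(** Induction on the distance in units of [h], gluing the coupling for one adjacent step to the one
    for the remaining path. *)
Lemma transport_path t (x y : G) : 0 <= t ->
  transport_le (pair_dist G) (P t x) (P t y)
    (expR (- kap * t) * l1_dist (val x) (val y)).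
Proof.
move=> t0; have [n] := grid_l1_dist K h N h_gt0 x y.
elim: n x => [|n IH] x xyn.
all: have [->|xy] := eqVneq x y; first by apply: transport_adjacent => //; left.
all: have [a [z [xz zy]]] := grid_step_towards K h N h_gt0 x y xy.
  (* At distance 0 a further step would make the distance [- h]. *)
  have : 0 <= l1_dist (val z) (val y) by exact: sumr_ge0.
  by rewrite zy xyn mul0r sub0r oppr_ge0 leNgt h_gt0.
have -> : expR (- kap * t) * l1_dist (val x) (val y) =
    expR (- kap * t) * l1_dist (val x) (val z) +
    expR (- kap * t) * l1_dist (val z) (val y).
  by rewrite -mulrDr zy xz (l1_dist_step h h_gt0) addrC subrK.
apply: transport_le_trans.
- exact: pair_dist_ge0.
- by move=> u v w; exact: l1_dist_triangle.
- by apply: transport_adjacent => //; right; exists a.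
- by apply: IH; rewrite zy xyn -natr1; ring.
Qed.

Lemma W1_contraction t (nu eta : G -> R) : 0 <= t -> is_pmf nu -> is_pmf eta ->
  W1 (fun y => \sum_x nu x * P t x y) (fun y => \sum_x eta x * P t x y) <=
    Num.sqrt d%:R * expR (- kap * t) * W1 nu eta.
Proof.
move=> t0 nuP etaP; set C := Num.sqrt _ * _.
have C0 : 0 < C by rewrite mulr_gt0 ?expR_gt0// sqrtr_gt0 ltr0n.
(* After division by the constant it suffices to bound the left side by the cost of each coupling of
   the initial laws. *)
rewrite mulrC -ler_pdivrMr//; apply: lb_le_inf.
  by eexists; exists (fun p => nu p.1 * eta p.2); first exact: coupling_prod.
move=> _ [g cg ->]; rewrite ler_pdivrMr//.
have mix := transport_le_mix (pair_dist G) (P t)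
  (fun p => expR (- kap * t) * l1_dist (val p.1) (val p.2)) nu eta g
  (fun x y => transport_path t x y t0) cg.
apply: le_trans (W1_le _ _ _ _ mix) _.
rewrite mulr_suml; apply: ler_sum => p _.
rewrite [leRHS]mulrAC ler_wpM2r ?(coupling_ge0 _ _ _ cg)// /C.
rewrite [leRHS]mulrC -mulrA mulrCA.
by rewrite ler_wpM2l ?expR_ge0// l1_le_eucl_norm.
Qed.

End Contraction.

(** * The rates of the grid chain *)

Section GridRate.
Context {R : realType} {d : nat} (K h sigma : R) (N : nat) (V : 'rV[R]_d -> R).
Local Notation I := ('I_d * bool)%type.
Local Notation G := (grid d K h N).

Lemma rate_ge0 (x : 'rV[R]_d) (a : I) : 0 <= rate K h sigma N V x a.
Proof.
rewrite /rate; case: ifP => // _.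
by rewrite mulr_ge0 ?expR_ge0// divr_ge0 ?sqr_ge0.
Qed.

Lemma rate_neq0 (x : 'rV[R]_d) (a : I) :
  rate K h sigma N V x a != 0 -> step h a x \in G.
Proof. by rewrite /rate; case: ifP; rewrite ?eqxx. Qed.

Lemma kappaE (x y : 'rV[R]_d) (a : I) : y = step h a x ->
  kappa K h sigma N V a x =
  meeting_rate (rate K h sigma N V x) (rate K h sigma N V y) a.
Proof. by move=> ->. Qed.

Hypothesis kappa_gt0 : forall (a : I) (x : 'rV[R]_d),
  x \in G -> step h a x \in G -> 0 < kappa K h sigma N V a x.

(** [kappa1] ranges over positive directions only; a negative one reduces to these by exchanging the
    endpoints. Positivity of [kappa] supplies the lower bound that the infimum requires. *)
Lemma kappa1_le (x y : 'rV[R]_d) (a : I) : x \in G -> y \in G ->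
  y = step h a x ->
  kappa1 K h sigma N V <=
  kappa K h sigma N V a x + kappa K h sigma N V (opp_move a) y.
Proof.
move=> xG yG xy; have yx : x = step h (opp_move a) y by rewrite xy step_oppK.
apply: ge_inf.
  exists 0 => _ [j [z [zG szG ->]]].
  rewrite addr_ge0// ltW// kappa_gt0//.
  by rewrite (step_oppK h (j, true)).
case: a xy yx => j [] xy yx; first by exists j, x; rewrite -xy.
exists j, y; rewrite -[(j, true)]/(opp_move (j, false)) -yx.
by split; [exact: yG | exact: xG | exact: addrC].
Qed.

End GridRate.

Theorem theorem8 (R : realType) (d : nat) (hd : (1 <= d)%N)
  (K h sigma : R) (hK : 0 < K) (hh : 0 < h) (hsigma : 0 < sigma)
  (N : nat) (hN : 2 * K / h = N%:R)
  (V : 'rV[R]_d -> R) (hV : Ck 2 V)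
  (hplus : forall (j : 'I_d) (i : 'rV[R]_d),
     i \in grid d K h N -> step h (j, true) i \in grid d K h N ->
     0 < kappa K h sigma N V (j, true) i)
  (hminus : forall (j : 'I_d) (i : 'rV[R]_d),
     i \in grid d K h N -> step h (j, false) i \in grid d K h N ->
     0 < kappa K h sigma N V (j, false) i)
  (nu eta : grid d K h N -> R) (hnu : is_pmf nu) (heta : is_pmf eta)
  (t : R) (ht : 0 <= t) :
  W1 (evolve sigma V nu t) (evolve sigma V eta t) <=
    Num.sqrt d%:R * expR (- kappa1 K h sigma N V * t) * W1 nu eta.
Proof.
have kappa_gt0 (a : 'I_d * bool) (x : 'rV[R]_d) : x \in grid d K h N ->
    step h a x \in grid d K h N -> 0 < kappa K h sigma N V a x.
  by case: a => j []; [exact: hplus | exact: hminus].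
pose r (x : grid d K h N) := rate K h sigma N V (val x).
(* [evolve] unfolds to the kernel of [exp_gen] for the rates [r] and the jumps [grid_step]. *)
apply: (W1_contraction K h N hd hh r) => //.
- by move=> x a; exact: rate_ge0.
- by move=> x a; exact: rate_neq0.
- move=> x y a xy; rewrite -(kappaE K h sigma N V _ _ _ xy).
  by rewrite kappa_gt0 -?xy ?fsvalP.
- move=> x y a xy; have yx : val x = step h (opp_move a) (val y).
    by rewrite xy step_oppK.
  rewrite -(kappaE K h sigma N V _ _ _ xy) -(kappaE K h sigma N V _ _ _ yx).
  by apply: kappa1_le; rewrite ?fsvalP.
Qed.
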